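(* The class of claw-free Berge graphs has the weighted strong Erdős–Hajnal property: there exists $\delta>0$ such that for every claw-free Berge graph $G$ and every probability measure $\mu$ on $V(G)$ with $\mu(\{v\})\leq 1-2\delta$ for all $v\in V(G)$, there exists a homogeneous pair $(P,Q)$ in $G$ with $\mu(P),\mu(Q)\geq\delta$.
   Context: All graphs are finite and simple. The claw is $K_{1,3}$; claw-free means no induced claw. A hole is an induced cycle of length at least $4$, an antihole is the complement of a hole; a graph is Berge if it has no odd hole and no odd antihole as induced subgraphs. For disjoint vertex sets $P,Q$, $(P,Q)$ is a homogeneous pair if either all edges between $P$ and $Q$ are present or none are. *)

(* Defs.v *)
From HB Require Import structures.
From mathcomp Require Import all_boot all_order all_algebra.
From mathcomp Require Import reals.

Set Implicit Arguments.
Unset Strict Implicit.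
Unset Printing Implicit Defensive.

Import Order.TTheory GRing.Theory Num.Theory.
Local Open Scope ring_scope.

Record sgraph := SGraph {
  vertex :> finType;
  adj : rel vertex;
  adj_sym : symmetric adj;
  adj_irr : irreflexive adj }.

Arguments adj {s} x y.

Definition induced_subgraph (H G : sgraph) : Prop :=
  exists f : H -> G, injective f /\ forall x y : H, adj (f x) (f y) = adj x y.

Section Complement.
Variable G : sgraph.

Definition co_adj (x y : G) : bool := (x != y) && ~~ adj x y.

Lemma co_adj_sym : symmetric co_adj.
Proof. by move=> x y; rewrite /co_adj eq_sym adj_sym. Qed.

Lemma co_adj_irr : irreflexive co_adj.
Proof. by move=> x; rewrite /co_adj eqxx. Qed.

Definition complement : sgraph := SGraph co_adj_sym co_adj_irr.
End Complement.

(* The complete bipartite graph K_{m,n}, with sides ['I_m] and ['I_n]. *)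
Section CompleteBipartite.
Variables m n : nat.

Definition bip_adj (x y : 'I_m + 'I_n) : bool :=
  match x, y with
  | inl _, inr _ | inr _, inl _ => true
  | _, _ => false
  end.

Lemma bip_adj_sym : symmetric bip_adj.
Proof. by case=> ? []. Qed.

Lemma bip_adj_irr : irreflexive bip_adj.
Proof. by case. Qed.

Definition complete_bipartite : sgraph := SGraph bip_adj_sym bip_adj_irr.
End CompleteBipartite.

(* [ordS i] is the cyclic successor of [i] in ['I_n]; the clause [i != j] only
   matters for [n = 1]. This is the cycle of length [n] when [3 <= n]. *)
Section Cycle.
Variable n : nat.

Definition cycle_adj (i j : 'I_n) : bool :=
  (i != j) && ((j == ordS i) || (i == ordS j)).

Lemma cycle_adj_sym : symmetric cycle_adj.
Proof. by move=> i j; rewrite /cycle_adj eq_sym orbC. Qed.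

Lemma cycle_adj_irr : irreflexive cycle_adj.
Proof. by move=> i; rewrite /cycle_adj eqxx. Qed.

Definition cycle_graph : sgraph := SGraph cycle_adj_sym cycle_adj_irr.
End Cycle.

Definition claw : sgraph := complete_bipartite 1 3.

Definition claw_free (G : sgraph) : Prop := ~ induced_subgraph claw G.

Definition has_odd_hole (G : sgraph) : Prop :=
  exists n : nat, [/\ (4 <= n)%N, odd n & induced_subgraph (cycle_graph n) G].

Definition has_odd_antihole (G : sgraph) : Prop :=
  exists n : nat,
    [/\ (4 <= n)%N, odd n & induced_subgraph (complement (cycle_graph n)) G].

Definition berge (G : sgraph) : Prop :=
  ~ has_odd_hole G /\ ~ has_odd_antihole G.

Definition homogeneous_pair (G : sgraph) (P Q : {set G}) : Prop :=
  [disjoint P & Q] /\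
  ((forall x y : G, x \in P -> y \in Q -> adj x y) \/
   (forall x y : G, x \in P -> y \in Q -> ~~ adj x y)).

(* Every subset of a finite set is measurable, and countable additivity
   amounts to finite additivity there. *)
Definition probability_measure (R : realType) (T : finType)
    (mu : {set T} -> R) : Prop :=
  [/\ forall A : {set T}, 0 <= mu A,
      forall A B : {set T}, [disjoint A & B] -> mu (A :|: B) = mu A + mu B
    & mu [set: T] = 1].

(* The bound [delta < 1/2] is implicit in the usual formulation: for
   [1/2 <= delta] no probability measure satisfies
   [mu [set v] <= 1 - 2 * delta] at every [v], and the property would hold
   vacuously for every class of graphs. *)
Definition weighted_strong_EH (R : realType) (C : sgraph -> Prop) : Prop :=
  exists delta : R,
    [/\ 0 < delta, delta < 2^-1 &
      forall G : sgraph, C G ->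
      forall mu : {set G} -> R, probability_measure mu ->
        (forall v : G, mu [set v] <= 1 - 2 * delta) ->
        exists P Q : {set G},
          [/\ homogeneous_pair P Q, delta <= mu P & delta <= mu Q]].

(* Main.v *)
(* Suppose no homogeneous pair has mass [d] on both sides. A vertex of mass [d]
   would form such a pair with its neighbours or its non-neighbours, so every
   vertex is light; splitting a clique in two shows that cliques are light. The
   complement of a neighbourhood is bipartite, so each neighbourhood is the
   union of two cliques and is light as well. Hence the graph is sparse, while
   any two disjoint sets of mass [d] are joined by an edge. In such a graph a
   claw is found by cutting the vertex set into five heavy blocks and
   repeatedly choosing, inside one block, a minimal set [D] whose neighbourhood
   has a prescribed mass in some other block: [D] then dominates a heavy
   part of that block and leaves a heavy part of each of the others untouched. *)
Require Import Defs.
From mathcomp Require Import all_boot all_order all_algebra.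
From mathcomp Require Import reals.
From mathcomp Require Import boolp lra zify.

Set Implicit Arguments.
Unset Strict Implicit.
Unset Printing Implicit Defensive.

Import Order.TTheory GRing.Theory Num.Theory.

(** * Odd closed walks, induced odd cycles and bipartitions *)

Section OddCycles.
Variables (T : finType) (e : rel T).

Lemma cycle_split_repeat x p1 p2 :
  cycle e (x :: p1 ++ x :: p2) = cycle e (x :: p1) && cycle e (x :: p2).
Proof. by rewrite /= rcons_cat cat_path /= !rcons_path; lia. Qed.

Lemma cycle_split_chord x y p1 p2 : symmetric e -> e x y ->
  cycle e (x :: p1 ++ y :: p2) ->
  cycle e (x :: rcons p1 y) /\ cycle e (x :: y :: p2).
Proof.
move=> esym exy /=; rewrite rcons_cat cat_path /= => /and3P[H1 H2 H3].
by rewrite exy H3 rcons_path last_rcons rcons_path H1 H2 esym exy.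
Qed.

Lemma nth_cycle x0 c i : cycle e c -> i < size c ->
  e (nth x0 c i) (nth x0 c (i.+1 %% size c)).
Proof.
case: c => // x p /= /(pathP x0) H Hi.
have:= H i; rewrite size_rcons => /(_ Hi).
have [->|ne] := eqVneq i (size p).
  by rewrite modnn /= nth_rcons ltnn eqxx nth_last -[x :: rcons p x]rcons_cons
    nth_rcons /= ltnSn -[nth _ (x :: p) _]/(nth x0 (x :: p) (size (x :: p)).-1)
    nth_last.
have lt : i < size p by lia.
by rewrite modn_small //= -rcons_cons !nth_rcons /= Hi lt.
Qed.

Hypotheses (esym : symmetric e) (eirr : irreflexive e).

Lemma rot_nth x0 (c : seq T) i j : i < j < size c -> exists p1 p2,
  [/\ rot i c = nth x0 c i :: p1 ++ nth x0 c j :: p2, size p1 = (j - i).-1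
    & (size p1 + size p2).+2 = size c].
Proof.
move=> /andP[ij jc]; have ic : i < size c by lia.
pose c1 := drop i.+1 c ++ take i c; pose k := (j - i).-1.
have rotc : rot i c = nth x0 c i :: c1 by rewrite /rot (drop_nth x0 ic).
have sz1 : (size c1).+1 = size c by rewrite -(size_rot i c) rotc.
have kc : k < size c1 by rewrite /k; lia.
have nk : nth x0 c1 k = nth x0 c j.
  rewrite nth_cat size_drop; have -> : k < size c - i.+1 by rewrite /k; lia.
  by rewrite nth_drop; congr nth; rewrite /k; lia.
exists (take k c1), (drop k.+1 c1); split.
- by rewrite -nk -drop_nth // cat_take_drop.
- by rewrite size_take kc.
by rewrite size_take kc size_drop; lia.
Qed.

(** The chord cuts the closed walk into two whose lengths add up to [size c + 2], so one of them is
    odd. The bounds on [j - i] say that each is shorter than [c]. *)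
Lemma shorten_at_chord x0 c i j : cycle e c -> i < j < size c ->
  e (nth x0 c i) (nth x0 c j) -> 1 < j - i < (size c).-1 -> odd (size c) ->
  exists c', [/\ cycle e c', odd (size c') & size c' < size c].
Proof.
move=> cc ij eij lohi oc; have [p1 [p2 [rotc s1 s2]]] := rot_nth x0 ij.
have : cycle e (rot i c) by rewrite rot_cycle.
rewrite rotc => /(cycle_split_chord esym eij)[C1 C2].
case: (boolP (odd (size p1))) => o1.
  by exists (nth x0 c i :: rcons p1 (nth x0 c j)); split=> //=;
    rewrite size_rcons; lia.
by exists [:: nth x0 c i, nth x0 c j & p2]; split=> //=; lia.
Qed.

Lemma shorten_at_repeat x0 c i j : cycle e c -> i < j < size c ->
  nth x0 c i = nth x0 c j -> odd (size c) ->
  exists c', [/\ cycle e c', odd (size c') & size c' < size c].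
Proof.
move=> cc ij eij oc; have [p1 [p2 [rotc s1 s2]]] := rot_nth x0 ij.
have : cycle e (rot i c) by rewrite rot_cycle.
rewrite rotc -eij cycle_split_repeat => /andP[C1 C2].
case: (boolP (odd (size p1))) => o1.
  by exists (nth x0 c i :: p2); split=> //=; lia.
by exists (nth x0 c i :: p1); split=> //=; lia.
Qed.

(** A shortest odd closed walk has neither a repeated vertex nor a chord, since either would yield a
    shorter one. *)
Lemma odd_cycle_induced c : cycle e c -> odd (size c) ->
  exists n (f : 'I_n -> T), [/\ odd n, 3 <= n, injective f
    & forall i j, e (f i) (f j) = cycle_adj i j].
Proof.
have [n] := ubnP (size c); elim: n c => // n IH c szc cc oc.
have [[c' [cc' oc' lt]]|nosh] :=
    pselect (exists c', [/\ cycle e c', odd (size c') & size c' < size c]).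
  by apply: (IH c') => //; lia.
have x0 : T by case: (c) oc.
have f_neq i j : i < j < size c -> nth x0 c i <> nth x0 c j.
  by move=> ij E; apply: nosh; exact: (shorten_at_repeat cc ij E).
have sz : 3 <= size c.
  by case: (c) cc oc => [|x [|y [|]]] //=; rewrite eirr.
exists (size c), (fun i => nth x0 c i); split=> //.
  move=> i j E; apply/val_inj/eqP; case: ltngtP => // ij.
    by case: (@f_neq i j) => //; rewrite ij ltn_ord.
  by case: (@f_neq j i) => //; rewrite ij ltn_ord.
have adjE i j : i < j < size c ->
    e (nth x0 c i) (nth x0 c j) = (j == i.+1 %% size c) || (i == j.+1 %% size c).
  move=> ij; apply/idP/idP => [eij|].
    have [m|m] := boolP (1 < j - i < (size c).-1).
      by case: nosh; exact: (shorten_at_chord cc ij eij m).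
    (* Outside the range of chords the two positions are cyclically consecutive, possibly across the
       end of the list. *)
    have [E|E] : j = i.+1 \/ (i = 0 /\ j = (size c).-1) by lia.
      by rewrite E modn_small ?eqxx //; lia.
    by case: E => -> ->; rewrite prednK ?modnn ?eqxx ?orbT //; lia.
  by case/orP => /eqP {1}->; [|rewrite esym]; apply: nth_cycle; lia.
move=> i j; rewrite /cycle_adj -!val_eqE /=.
have [ij|ij|/val_inj ->] := ltngtP i j.
- by rewrite adjE // ij ltn_ord.
- by rewrite esym adjE ?ij ?ltn_ord //= orbC.
- by rewrite eirr.
Qed.

Definition parity_walk x y b :=
  exists p, [/\ path e x p, last x p = y & odd (size p) = b].

Lemma parity_walk_cat x y z a b :
  parity_walk x y a -> parity_walk y z b -> parity_walk x z (a (+) b).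
Proof.
move=> [p [pp lp <-]] [q [pq lq <-]]; exists (p ++ q).
by rewrite cat_path pp lp last_cat lp lq size_cat oddD.
Qed.

Lemma parity_walk_sym x y b : parity_walk x y b -> parity_walk y x b.
Proof.
move=> [p [pp lp <-]]; exists (rev (belast x p)); split.
- by rewrite -lp rev_path; under eq_path do rewrite esym.
- by case: (p) lp => //= z q _; rewrite rev_cons last_rcons.
- by rewrite size_rev size_belast.
Qed.

Lemma parity_walk_cycle x : parity_walk x x true ->
  exists c, cycle e c /\ odd (size c).
Proof.
move=> [p []]; case/lastP: p => // q y.
rewrite last_rcons size_rcons => pq yx oq.
by exists (x :: q); split=> //=; rewrite -{2}yx.
Qed.

(** One side consists of the vertices reached by an even walk from the root of their component. *)
Lemma bipartition :
  (forall c, cycle e c -> ~~ odd (size c)) ->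
  exists A : {set T}, forall x y, e x y -> (x \in A) != (y \in A).
Proof.
move=> noodd; have csym := sym_connect_sym esym.
have noclosed x : ~ parity_walk x x true.
  by move=> /parity_walk_cycle[c [/noodd/negP]].
exists [set x | `[< parity_walk (fingraph.root e x) x false >]] => x y exy.
have rxy : fingraph.root e x = fingraph.root e y by apply/(fingraph.rootP csym)/connect1.
have exy' : parity_walk x y true by exists [:: y]; rewrite /= exy.
have walk z : exists b, parity_walk (fingraph.root e z) z b.
  have : connect e (fingraph.root e z) z by rewrite csym connect_root.
  by case/connectP => p pp lp; exists (odd (size p)), p.
(* Walks of equal parity from the common root to both ends of an edge would close up to an odd
   walk. *)
have same b : parity_walk (fingraph.root e x) x b -> ~ parity_walk (fingraph.root e y) y b.
  move=> wx; rewrite -rxy => /parity_walk_sym wy.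
  have := parity_walk_cat (parity_walk_cat wx exy') wy.
  by rewrite addbT addNb addbb => /noclosed.
rewrite !inE; case: asboolP => wx; case: asboolP => wy //.
  by case: (same _ wx).
have [[] wx'] // := walk x; have [[] wy'] // := walk y.
by case: (same _ wx').
Qed.

End OddCycles.

(** * Claws and the structure of neighbourhoods *)

Lemma claw_intro (G : sgraph) (v a b c : G) :
  adj v a -> adj v b -> adj v c -> a != b -> a != c -> b != c ->
  ~~ adj a b -> ~~ adj a c -> ~~ adj b c -> induced_subgraph claw G.
Proof.
move=> va vb vc ab ac bc nab nac nbc.
pose s := [:: a; b; c].
pose f (x : claw) : G := match x with inl _ => v | inr i => nth v s i end.
have fv (i : 'I_3) : adj v (f (inr i)) by case: i => [[|[|[|?]]] ?].
have fs (i j : 'I_3) : ~~ adj (f (inr i)) (f (inr j)).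
  by case: i j => [[|[|[|?]]] ?] [[|[|[|?]]] ?] //=; rewrite ?adj_irr // adj_sym.
exists f; split.
  have vf i : v <> f (inr i) by move=> E; have := fv i; rewrite -E adj_irr.
  case=> i [] j.
  - by rewrite !ord1.
  - by move/vf.
  - by move/esym/vf.
  have us : uniq s by rewrite /= !inE negb_or ab ac bc.
  by move=> /= /eqP; rewrite nth_uniq ?ltn_ord // => /eqP/val_inj ->.
case=> i [] j /=.
- by rewrite adj_irr.
- exact: fv.
- by rewrite adj_sym; exact: fv.
- exact/negbTE/fs.
Qed.

Lemma modnS_neq n i : 1 < n -> i < n -> i.+1 %% n != i.
Proof.
move=> n1 lt; have [E|ne] := eqVneq i.+1 n; first by rewrite E modnn; lia.
by rewrite modn_small; lia.
Qed.

(* The complement of a neighbourhood is triangle-free, as [G] is claw-free,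
   and an odd induced cycle of length at least five in it is an odd antihole
   of [G]; hence it is bipartite. *)
Lemma nbr_two_cliques (G : sgraph) (v : G) :
  claw_free G -> ~ has_odd_antihole G ->
  exists A : {set G}, forall x y, adj v x -> adj v y -> x != y ->
    (x \in A) = (y \in A) -> adj x y.
Proof.
move=> nclaw nanti.
pose e x y := [&& adj v x, adj v y, x != y & ~~ adj x y].
have esym : symmetric e.
  by move=> x y; rewrite /e [y == x]eq_sym [adj y x]adj_sym andbCA.
have eirr : irreflexive e by move=> x; rewrite /e eqxx !andbF.
have [|A HA] := bipartition esym.
  move=> c cc; apply/negP => oc.
  have [n [f [on n3 fi fE]]] := odd_cycle_induced esym eirr cc oc.
  have vf i : adj v (f i).
    have : e (f i) (f (ordS i)).
      rewrite fE /cycle_adj eqxx -val_eqE /= andbT eq_sym.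
      by apply: modnS_neq => //; lia.
    (* Each [f i] has an [e]-neighbour on the cycle, and [e] relates only neighbours of [v]. *)
    by case/andP.
  have [n4|n4] := leqP 4 n.
    apply: nanti; exists n; split=> //; exists f; split=> // x y /=.
    rewrite /co_adj /=; have := fE x y; rewrite /e !vf (inj_eq fi) /=.
    have [->|_] /= := eqVneq x y; first by rewrite adj_irr.
    by move=> <-; rewrite negbK.
  have E : n = 3 by lia.
  move: f fi fE vf; rewrite E => f fi fE vf.
  pose a := @Ordinal 3 0 isT; pose b := @Ordinal 3 1 isT.
  pose d := @Ordinal 3 2 isT.
  have sep i j : cycle_adj i j -> (f i != f j) /\ ~~ adj (f i) (f j).
    by rewrite -fE => /and4P[].
  have [[ab nab] [ad nad] [bd nbd]] :=
    And3 (sep a b isT) (sep a d isT) (sep b d isT).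
  exact/nclaw/(claw_intro (vf a) (vf b) (vf d)).
exists A => x y vx vy xy Axy; apply/negPn/negP => nxy.
by have := HA x y; rewrite /e vx vy xy nxy Axy eqxx => /(_ isT).
Qed.

(** * Disjointness, measures and neighbourhoods of sets *)

Local Open Scope ring_scope.

(* A constant of its own, since [auto] cannot usefully index [disjoint]. *)
Definition disj (T : finType) (A B : {set T}) : bool := [disjoint A & B].

Lemma disj_sym (T : finType) (A B : {set T}) : disj A B -> disj B A.
Proof. by rewrite /disj disjoint_sym. Qed.

Lemma disj_setD (T : finType) (A B : {set T}) : disj A (B :\: A).
Proof. by apply/pred0P => x; rewrite /= !inE; case: (x \in A). Qed.

Lemma disjIl (T : finType) (A B C : {set T}) : disj A B -> disj (A :&: C) B.
Proof. exact: disjointWl (subsetIl _ _). Qed.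

Lemma disjIr (T : finType) (A B C : {set T}) : disj A B -> disj A (B :&: C).
Proof. exact: disjointWr (subsetIl _ _). Qed.

Lemma disjDl (T : finType) (A B C : {set T}) : disj A B -> disj (A :\: C) B.
Proof. exact: disjointWl (subsetDl _ _). Qed.

Lemma disjDr (T : finType) (A B C : {set T}) : disj A B -> disj A (B :\: C).
Proof. exact: disjointWr (subsetDl _ _). Qed.

#[local] Hint Resolve disj_setD disjIl disjIr disjDl disjDr : core.
#[local] Hint Immediate disj_sym : core.

Section Measure.
Variables (R : realType) (T : finType) (mu : {set T} -> R).
Hypothesis mu_prob : probability_measure mu.
Implicit Types (A B S : {set T}) (a d : R).

Lemma measure_ge0 A : 0 <= mu A. Proof. by case: mu_prob. Qed.

Lemma measureID A B : mu A = mu (A :&: B) + mu (A :\: B).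
Proof.
case: mu_prob => _ add _; rewrite -add ?setID //.
exact: disjointWl (subsetIr _ _) (disj_setD _ _).
Qed.

Lemma le_measure A B : A \subset B -> mu A <= mu B.
Proof.
move=> /setIidPr sAB; rewrite (measureID B A) sAB.
by rewrite lerDl measure_ge0.
Qed.

Lemma measure0 : mu set0 = 0.
Proof.
by have := measureID set0 set0; rewrite setI0 setD0; lra.
Qed.

Lemma measureU_le A B : mu (A :|: B) <= mu A + mu B.
Proof.
rewrite (measureID (A :|: B) A) setUK lerD2l.
by apply: le_measure; rewrite setDUl setDv set0U subsetDl.
Qed.

(** In a minimal subset of mass at least [a], deleting any vertex brings the mass below [a], so the
    excess is less than the mass of one vertex. *)
Lemma exists_submeasure S a d : 0 <= a -> 0 < d -> a <= mu S ->
  (forall v, mu [set v] < d) ->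
  exists2 A : {set T}, A \subset S & a <= mu A < a + d.
Proof.
move=> a0 d0 aS small.
have [A /minsetP[aA minA] sAS] :=
  minset_exists (P := fun A : {set T} => a <= mu A) aS.
exists A; rewrite // aA /=.
have [A0|[v vA]] := set_0Vmem A.
  by move: aA; rewrite A0 measure0; lra.
have lt : mu (A :\ v) < a.
  rewrite ltNge; apply/negP => /minA/(_ (subD1set _ _)) E.
  by move: vA; rewrite -E setD11.
have := measureU_le [set v] (A :\ v); rewrite setD1K //.
by have := small v; lra.
Qed.

End Measure.

(** This set may meet [S] and need not contain it, so disjointness from [S] and from [nbrs S] are
    separate conditions below. *)
Definition nbrs (G : sgraph) (S : {set G}) : {set G} :=
  [set y | [exists x in S, adj x y]].

Lemma nbrsP (G : sgraph) (S : {set G}) y :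
  reflect (exists2 x, x \in S & adj x y) (y \in nbrs S).
Proof. by rewrite inE; apply: exists_inP. Qed.

Lemma nbrsU (G : sgraph) (S S' : {set G}) :
  nbrs (S :|: S') \subset nbrs S :|: nbrs S'.
Proof.
apply/subsetP => y /nbrsP[x]; rewrite !in_setU.
by case/orP => xS xy; apply/orP; [left|right]; apply/nbrsP; exists x.
Qed.

Lemma nbrs0 (G : sgraph) : nbrs (set0 : {set G}) = set0.
Proof.
by apply/setP=> y; rewrite in_set0; apply/negbTE/negP => /nbrsP[x]; rewrite inE.
Qed.

(** * Graphs without a heavy homogeneous pair *)

Section NoHomogeneousPair.
Variables (R : realType) (G : sgraph) (mu : {set G} -> R) (d : R).
Hypothesis mu_prob : probability_measure mu.
Hypothesis d_gt0 : 0 < d.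
Hypothesis small : forall v, mu [set v] < d.
Hypothesis no_pair :
  forall P Q, homogeneous_pair P Q -> d <= mu P -> mu Q < d.
Hypotheses (nclaw : claw_free G) (nanti : ~ has_odd_antihole G).
Implicit Types A B C D S T X Z P Q K : {set G}.

(** A part of mass in [[d, 2 * d)] would leave at least [d] for the rest of the clique, and the two
    parts are complete to each other. *)
Lemma clique_small K :
  (forall x y, x \in K -> y \in K -> x != y -> adj x y) -> mu K < 3 * d.
Proof.
move=> Kcl; rewrite ltNge; apply/negP => bigK.
have [||P sPK /andP[dP Pd]] :=
  exists_submeasure mu_prob (S := K) (a := d) (ltW d_gt0) d_gt0.
- by move: d_gt0 bigK; lra.
- exact: small.
have := measureID mu_prob K P; rewrite (setIidPr sPK) => KE.
suff /no_pair/(_ dP) : homogeneous_pair P (K :\: P) by lra.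
split; first exact: disj_setD.
left=> x y xP /setDP[yK yP]; apply: Kcl => //; first exact: (subsetP sPK).
by apply: contraNneq yP => <-.
Qed.

Lemma nbrs_small v : mu (nbrs [set v]) < 6 * d.
Proof.
have [A HA] := nbr_two_cliques v nclaw nanti.
have nP x : x \in nbrs [set v] -> adj v x by case/nbrsP => _ /set1P ->.
rewrite (measureID mu_prob _ A).
have : mu (nbrs [set v] :&: A) < 3 * d.
  apply: clique_small => x y /setIP[vx xA] /setIP[vy yA] xy.
  by apply: HA; rewrite ?nP // xA yA.
have : mu (nbrs [set v] :\: A) < 3 * d.
  apply: clique_small => x y /setDP[vx xA] /setDP[vy yA] xy.
  by apply: HA; rewrite ?nP // (negbTE xA) (negbTE yA).
lra.
Qed.

Lemma edge_between P Q : disj P Q -> d <= mu P -> d <= mu Q ->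
  exists x y, [/\ x \in P, y \in Q & adj x y].
Proof.
move=> dPQ dP dQ; apply: contrapT => none.
suff /no_pair/(_ dP) : homogeneous_pair P Q by rewrite ltNge dQ.
split=> //; right=> x y xP yQ; apply/negP => xy; apply: none.
by exists x, y.
Qed.

(** No edge joins [S] to the part of [T] outside [nbrs S]. *)
Lemma expansion S T : disj S T -> d <= mu S ->
  mu (T :\: nbrs S) < d.
Proof.
move=> dST dS; rewrite ltNge; apply/negP => dT.
have [|x [y [xS /setDP[_ /negP yS] xy]]] := edge_between _ dS dT.
  exact: disjointWr (subsetDl _ _) dST.
by apply: yS; apply/nbrsP; exists x.
Qed.

(* A minimal [D] whose neighbourhood has mass [t] in some target overshoots
   in no target by more than the mass of a single neighbourhood. *)
Lemma balanced_expander S (Ts : seq {set G}) T0 t : 0 < t -> d <= mu S ->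
  T0 \in Ts -> disj S T0 -> t + d <= mu T0 ->
  exists D, [/\ D \subset S,
    exists2 T, T \in Ts & t <= mu (T :&: nbrs D) &
    forall T, T \in Ts -> mu T - t - 6 * d <= mu (T :\: nbrs D)].
Proof.
move=> t0 dS T0s dST big.
pose good D := has (fun T => t <= mu (T :&: nbrs D)) Ts.
have goodS : good S.
  apply/hasP; exists T0 => //; have := measureID mu_prob T0 (nbrs S).
  by have := expansion dST dS; lra.
have [D /minsetP[goodD minD] sDS] := minset_exists goodS.
exists D; split=> //; first exact/hasP.
have [v vD] : exists v, v \in D.
  apply/set0Pn; apply/negP => /eqP D0.
  move: goodD; rewrite /good D0 nbrs0 => /hasP[T _].
  by rewrite setI0 (measure0 mu_prob); lra.
(* By minimality [D :\ v] covers less than [t] of every target; restoring [v] adds less than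
   [6 * d]. *)
move=> T Ts_T; have lt : mu (T :&: nbrs (D :\ v)) < t.
  rewrite ltNge; apply/negP => le.
  have : good (D :\ v) by apply/hasP; exists T.
  by move/minD/(_ (subD1set _ _)) => E; move: vD; rewrite -E setD11.
have := measureID mu_prob T (nbrs D).
suff : mu (T :&: nbrs D) <= mu (nbrs [set v]) + mu (T :&: nbrs (D :\ v)).
  by have := nbrs_small v; lra.
apply: le_trans (measureU_le mu_prob _ _); apply: le_measure => //.
rewrite -{1}(setD1K vD); apply: subset_trans (setIS _ (nbrsU _ _)) _.
by rewrite setIUr setSU // subsetIr.
Qed.

(** The claw has its centre in [C :&: nbrs D], and one leaf in each of [X], [D] and [Z]. An edge
    from the centre to [Z] exists because both sets are heavy; the leaves are non-adjacent as [D]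
    and [Z] avoid [nbrs X] and the leaf in [Z] is chosen outside [nbrs D]. *)
Lemma no_tripod X C D Z : C \subset nbrs X ->
  disj X D -> disj (nbrs X) D ->
  disj X Z -> disj (nbrs X) Z ->
  disj D Z -> disj C Z ->
  d <= mu (C :&: nbrs D) -> d <= mu (Z :\: nbrs D) -> False.
Proof.
move=> CX XD NXD XZ NXZ DZ CZ dC dZ.
have [|c [z [/setIP[cC cD] /setDP[zZ zD] cz]]] := edge_between _ dC dZ.
  exact: disjointW (subsetIl _ _) (subsetDl _ _) CZ.
have /nbrsP[x xX xc] := subsetP CX c cC.
have /nbrsP[u uD uc] := cD.
have noadj A a b : a \in A -> b \notin nbrs A -> ~~ adj a b.
  by move=> aA; apply: contra => ab; apply/nbrsP; exists a.
have neq A B a b : disj A B -> a \in A -> b \in B -> a != b.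
  by move=> dAB aA bB; apply: contraTneq bB => <-; rewrite (disjointFr dAB).
rewrite adj_sym in xc; rewrite adj_sym in uc.
apply/nclaw/(claw_intro xc uc cz).
- exact: (neq _ _ _ _ XD).
- exact: (neq _ _ _ _ XZ).
- exact: (neq _ _ _ _ DZ).
- by apply: (noadj X) => //; rewrite (disjointFl NXD).
- by apply: (noadj X) => //; rewrite (disjointFl NXZ).
- by apply: (noadj D).
Qed.

Lemma disj_sub_l D S A : D \subset S -> disj S A -> disj D A.
Proof. exact: disjointWl. Qed.

Lemma disj_sub_r D S A : D \subset S -> disj A S -> disj A D.
Proof. exact: disjointWr. Qed.

(* The thresholds are 8 = 2 * 1 + 6, 22 = 2 * 8 + 6 and 50 = 2 * 22 + 6: a target
   of mass [(2 t + 6) d] loses less than [(t + 6) d] to the neighbourhood of a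
   balanced expander for [t d]. *)
Lemma no_two_stars X1 X2 C1 C2 S :
  C1 \subset nbrs X1 -> C2 \subset nbrs X2 ->
  disj X1 S -> disj (nbrs X1) S -> disj X1 C2 -> disj (nbrs X1) C2 ->
  disj X2 S -> disj (nbrs X2) S -> disj X2 C1 -> disj (nbrs X2) C1 ->
  disj S C1 -> disj S C2 -> disj C1 C2 ->
  8 * d <= mu S -> 8 * d <= mu C1 -> 8 * d <= mu C2 -> False.
Proof.
move=> CX1 CX2 X1S N1S X1C N1C X2S N2S X2C N2C SC1 SC2 C12 bS b1 b2.
have d0 := d_gt0.
have [||D [sDS [T Ts covT] low]] :=
  @balanced_expander S [:: C1; C2] C1 d d_gt0 _ (mem_head _ _) SC1.
- by lra.
- by lra.
have low1 : d <= mu (C1 :\: nbrs D) by have := low _ (mem_head _ _); lra.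
have low2 : d <= mu (C2 :\: nbrs D).
  by have := low C2; rewrite !inE eqxx orbT => /(_ isT); lra.
have dl A := @disj_sub_l _ _ A sDS; have dr A := @disj_sub_r _ _ A sDS.
(* The star whose [C] is covered by [D] becomes a tripod, and the other [C] provides the third
   leaf. *)
move: Ts covT; rewrite !inE => /orP[] /eqP -> covT.
  by apply: (@no_tripod X1 C1 D C2); auto.
by apply: (@no_tripod X2 C2 D C1); auto.
Qed.

(** An expander [D] inside [S] either covers a heavy part of [C], which gives a tripod, or covers a
    heavy part of some [Ti]. In the latter case [D] is the base of a second star, and the other [Ti]
    is the free block of [no_two_stars]. *)
Lemma no_star X C S T1 T2 : C \subset nbrs X ->
  disj X S -> disj (nbrs X) S -> disj X T1 -> disj (nbrs X) T1 ->
  disj X T2 -> disj (nbrs X) T2 -> disj S C -> disj S T1 -> disj S T2 ->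
  disj C T1 -> disj C T2 -> disj T1 T2 ->
  22 * d <= mu S -> 22 * d <= mu C -> 22 * d <= mu T1 -> 22 * d <= mu T2 ->
  False.
Proof.
move=> CX XS NS X1 N1 X2 N2 SC S1 S2 C1 C2 T12 bS bC b1 b2.
have d0 := d_gt0.
have [|||D [sDS [T Ts covT] low]] :=
  @balanced_expander S [:: C; T1; T2] C (8 * d) _ _ (mem_head _ _) SC.
- by lra.
- by lra.
- by lra.
have lowT A : A \in [:: C; T1; T2] -> 22 * d <= mu A ->
    8 * d <= mu (A :\: nbrs D) by move/low; lra.
have lowC : 8 * d <= mu (C :\: nbrs D) by apply: lowT; rewrite // !inE eqxx.
have low1 : 8 * d <= mu (T1 :\: nbrs D).
  by apply: lowT; rewrite // !inE eqxx orbT.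
have low2 : 8 * d <= mu (T2 :\: nbrs D).
  by apply: lowT; rewrite // !inE eqxx !orbT.
have dl A := @disj_sub_l _ _ A sDS; have dr A := @disj_sub_r _ _ A sDS.
have CX' : C :\: nbrs D \subset nbrs X := subset_trans (subsetDl _ _) CX.
have mD A : A :&: nbrs D \subset nbrs D := subsetIr _ _.
move: Ts covT; rewrite !inE => /or3P[] /eqP -> covT.
- have le8 A : 8 * d <= mu A -> d <= mu A by lra.
  by apply: (@no_tripod X C D T1); auto.
- by apply: (@no_two_stars X D (C :\: nbrs D) (T1 :&: nbrs D)
    (T2 :\: nbrs D)); auto.
- by apply: (@no_two_stars X D (C :\: nbrs D) (T2 :&: nbrs D)
    (T1 :\: nbrs D)); auto.
Qed.

Lemma no_five_blocks S T1 T2 T3 T4 :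
  pairwise (@disj G) [:: S; T1; T2; T3; T4] ->
  all (fun A => 50 * d <= mu A) [:: S; T1; T2; T3; T4] -> False.
Proof.
rewrite /= !andbT => /and4P[/and4P[S1 S2 S3 S4] /and3P[D12 D13 D14]].
move=> /andP[D23 D24] D34 /and5P[bS b1 b2 b3 b4].
have d0 := d_gt0.
have [|||D [sDS [T Ts covT] low]] :=
  @balanced_expander S [:: T1; T2; T3; T4] T1 (22 * d) _ _ (mem_head _ _) S1.
- by lra.
- by lra.
- by lra.
have lowT A : A \in [:: T1; T2; T3; T4] -> 50 * d <= mu A ->
    22 * d <= mu (A :\: nbrs D) by move/low; lra.
have low1 : 22 * d <= mu (T1 :\: nbrs D).
  by apply: lowT; rewrite // !inE eqxx.
have low2 : 22 * d <= mu (T2 :\: nbrs D).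
  by apply: lowT; rewrite // !inE eqxx !orbT.
have low3 : 22 * d <= mu (T3 :\: nbrs D).
  by apply: lowT; rewrite // !inE eqxx !orbT.
have low4 : 22 * d <= mu (T4 :\: nbrs D).
  by apply: lowT; rewrite // !inE eqxx !orbT.
have dl A := @disj_sub_l _ _ A sDS; have dr A := @disj_sub_r _ _ A sDS.
(* [A1] stands for the target that [D] covers: its covered part forms the first star with [D], and
   the remnants of the other three are the untouched blocks. *)
have key A1 A2 A3 A4 : disj S A1 -> disj S A2 -> disj S A3 -> disj S A4 ->
    disj A1 A2 -> disj A1 A3 -> disj A1 A4 -> disj A2 A3 -> disj A2 A4 ->
    disj A3 A4 -> 22 * d <= mu (A1 :&: nbrs D) ->
    22 * d <= mu (A2 :\: nbrs D) -> 22 * d <= mu (A3 :\: nbrs D) ->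
    22 * d <= mu (A4 :\: nbrs D) -> False.
  move=> *; have mD := subsetIr A1 (nbrs D).
  by apply: (@no_star D (A1 :&: nbrs D) (A2 :\: nbrs D)
    (A3 :\: nbrs D) (A4 :\: nbrs D)); auto.
move: Ts covT; rewrite !inE => /or4P[] /eqP -> covT.
- by apply: (key T1 T2 T3 T4); auto.
- by apply: (key T2 T1 T3 T4); auto.
- by apply: (key T3 T1 T2 T4); auto.
- by apply: (key T4 T1 T2 T3); auto.
Qed.

(** Blocks are cut greedily from the remainder [U]; each costs at most [51 * d], namely [50 * d]
    plus an excess below [d]. *)
Lemma disjoint_blocks n : n%:R * (51 * d) <= 1 ->
  exists (s : seq {set G}) (U : {set G}),
    [/\ size s = n, pairwise (@disj G) s,
     all (fun A => 50 * d <= mu A) s, all (fun A => disj U A) s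
     & 1 - n%:R * (51 * d) <= mu U].
Proof.
have d0 := d_gt0; elim: n => [|n IH] nd.
  by exists [::], setT; case: mu_prob => _ _ ->; split=> //; rewrite mul0r subr0.
move: nd; rewrite -natr1 => nd.
have [|s [U [ss ps bs dUs bU]]] := IH; first by lra.
have [||A sAU /andP[bA Ab]] :=
  exists_submeasure mu_prob (S := U) (a := 50 * d) _ d_gt0 _ small.
- by lra.
- by lra.
have := measureID mu_prob U A; rewrite (setIidPr sAU) => UE.
exists (A :: s), (U :\: A); split=> /=; last by lra.
- by rewrite ss.
- rewrite ps andbT; apply: sub_all dUs => B; exact: disjointWl.
- by rewrite bA.
rewrite disj_sym ?disj_setD //=.
by apply: sub_all dUs => B; exact/disjointWl/subsetDl.
Qed.

Lemma no_pair_absurd : 255 * d <= 1 -> False.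
Proof.
move=> d255; have [|s [U [ss ps bs _ _]]] := disjoint_blocks (n := 5).
  by lra.
move: s ss ps bs => [|S [|T1 [|T2 [|T3 [|T4 []]]]]] // _.
exact: no_five_blocks.
Qed.

End NoHomogeneousPair.

(** * Heavy vertices and the conclusion *)

Lemma heavy_vertex (R : realType) (G : sgraph) (mu : {set G} -> R) d (v : G) :
  probability_measure mu -> d <= mu [set v] -> mu [set v] <= 1 - 2 * d ->
  exists P Q, [/\ homogeneous_pair P Q, d <= mu P & d <= mu Q].
Proof.
move=> mu_prob dv vd; have [_ _ mu1] := mu_prob.
have := measureID mu_prob setT [set v]; rewrite setTI mu1.
rewrite (measureID mu_prob (setT :\: _) [set u | adj v u]).
set P := _ :&: _; set Q := _ :\: _ => E.
(* The other vertices have total mass at least [2 * d], so the neighbours or the non-neighbours of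
   [v] have mass at least [d]. *)
have [dP|dP] := lerP d (mu P).
  exists [set v], P; split=> //; split; last left.
    exact: disjointWr (subsetIl _ _) (disj_setD _ _).
  by move=> x y /set1P -> /setIP[_]; rewrite inE.
exists [set v], Q; split=> //; last by lra.
split; last right.
  exact: disjointWr (subsetDl _ _) (disj_setD _ _).
by move=> x y /set1P -> /setDP[_]; rewrite inE.
Qed.

Theorem theorem3p1 (R : realType) :
  weighted_strong_EH R (fun G : sgraph => claw_free G /\ berge G).
Proof.
(* Five blocks at a cost of [51 * d] each require [255 * d <= 1]. *)
exists (255%:R^-1); split; [by lra | by lra |].
move=> G [nclaw [_ nanti]] mu mu_prob le_mu.
set d := 255%:R^-1 in le_mu *; apply: contrapT => none.
have d0 : 0 < d by rewrite /d; lra.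
apply: (@no_pair_absurd R G mu d) => //; last by rewrite /d; lra.
- move=> v; rewrite ltNge; apply/negP => dv.
  exact/none/(heavy_vertex mu_prob dv).
move=> P Q PQ dP; rewrite ltNge; apply/negP => dQ.
by apply: none; exists P, Q.
Qed.
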